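(* Let $n\ge3$ and $f(x)=\sum_{i\in[n-1]}a_ix_ix_{i+1}+x_1x_n$ for $x\in\{0,1\}^n$, where $a_i<0$ for $i\in[n-1]$. Then the convex envelope of $f$ over $[0,1]^n$ is given by $$\begin{aligned}r(x):={}&\max\{0,x_1+x_n-1\}+\sum_{i\in[n-1]}a_i\min\{x_i,x_{i+1}\}\\&+a\cdot\max\Bigl\{0,\ \sum_{i\in[n-1]}\min\{x_i,x_{i+1}\}-\max\{0,x_1+x_n-1\}-\sum_{i=2}^{n-1}x_i\Bigr\},\end{aligned}$$ where $a:=\min\{|a_1|,\dots,|a_{n-1}|,1\}$.
   Context: $[m]=\{1,\dots,m\}$. The convex envelope of $f:\{0,1\}^n\to\mathbb{R}$ over $[0,1]^n=\operatorname{conv}(\{0,1\}^n)$ is the largest convex function on $[0,1]^n$ that is $\le f$ on $\{0,1\}^n$. *)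

(* Defs.v *)
From mathcomp Require Import all_boot all_order all_algebra.
From mathcomp Require Import all_classical all_reals all_analysis.

Set Implicit Arguments.
Unset Strict Implicit.
Unset Printing Implicit Defensive.

Import Order.TTheory GRing.Theory Num.Theory.
Local Open Scope classical_set_scope.
Local Open Scope ring_scope.

Definition unit_cube (R : realType) (n : nat) : set 'rV[R]_n :=
  [set x | forall j, 0 <= x 0 j <= 1].

Definition cube_vertices (R : realType) (n : nat) : set 'rV[R]_n :=
  [set x | forall j, x 0 j = 0 \/ x 0 j = 1].

(* The functions f, g and h are total on R^n, but only the values of f on
   {0,1}^n and the values of g and h on [0,1]^n are constrained. *)
Definition is_convex_envelope (R : realType) (n : nat)
    (f g : 'rV[R]_n -> R) : Prop :=
  [/\ convex_function (@unit_cube R n) g,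
      forall v, cube_vertices v -> g v <= f v
    & forall h : 'rV[R]_n -> R,
        convex_function (@unit_cube R n) h ->
        (forall v, cube_vertices v -> h v <= f v) ->
        forall x, unit_cube x -> h x <= g x].

(* Points have n = m.+1 coordinates x_1, ..., x_n, stored at the indices
   0, ..., m, so that ord0 is the index of x_1 and ord_max that of x_n.
   An index i : 'I_m stands for the pair of consecutive coordinates stored
   at edge_tail i = i and edge_head i = i.+1. *)
Definition edge_tail (m : nat) (i : 'I_m) : 'I_m.+1 := widen_ord (leqnSn m) i.
Definition edge_head (m : nat) (i : 'I_m) : 'I_m.+1 := lift ord0 i.

Definition cycle_fun (R : realType) (m : nat) (a : 'I_m -> R)
    (x : 'rV[R]_m.+1) : R :=
  \sum_(i < m) a i * x 0 (edge_tail i) * x 0 (edge_head i) + x 0 ord0 * x 0 ord_max.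

Definition min_coef (R : realType) (m : nat) (a : 'I_m -> R) : R :=
  \big[Num.min/1]_(i < m) `|a i|.

Definition cycle_env (R : realType) (m : nat) (a : 'I_m -> R)
    (x : 'rV[R]_m.+1) : R :=
  Num.max 0 (x 0 ord0 + x 0 ord_max - 1)
  + \sum_(i < m) a i * Num.min (x 0 (edge_tail i)) (x 0 (edge_head i))
  + min_coef a *
    Num.max 0 (\sum_(i < m) Num.min (x 0 (edge_tail i)) (x 0 (edge_head i))
               - Num.max 0 (x 0 ord0 + x 0 ord_max - 1)
               - \sum_(j < m.+1 | (0 < j < m)%N) x 0 j).

(* Main.v *)
Require Import Defs.
From mathcomp Require Import all_boot all_order all_algebra.
From mathcomp Require Import all_classical all_reals all_analysis.
From mathcomp Require Import ring lra zify.

Set Implicit Arguments.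
Unset Strict Implicit.
Unset Printing Implicit Defensive.

Import Order.TTheory GRing.Theory Num.Theory.
Local Open Scope ring_scope.

(** Write M for max(0, x_1 + x_n - 1), S for the sum of min(x_i, x_{i+1}) over
    the path edges, T for the sum of the interior coordinates, and
    gap = S - M - T; the candidate is M + sum_i a_i min(x_i, x_{i+1})
    + c max(0, gap), where c is the least of 1 and the |a_i|.

    Convexity looks doubtful, because S enters the last term with a positive
    coefficient.  But the candidate is the maximum of its value without the
    last term and of (1 - c) M + sum_i (a_i + c) min(x_i, x_{i+1}) - c T.  As
    c <= 1 and c <= - a_i, both are sums of maxima of affine functions
    ([cycle_env_convex]).  At a vertex the minima are the products of f, and
    the gap is nonpositive ([cycle_env_le_vertex]).

    For maximality, let X be a random 0/1 vector with mean x.  Jensen's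
    inequality gives h(x) <= E h(X) <= E f(X) for every convex h that is
    below f on the vertices ([convex_le_mean]), so it suffices to find an X
    with E f(X) equal to the candidate.  This asks P(X_i = X_{i+1} = 1) to be
    as large as possible on the path edges and P(X_1 = X_n = 1) to be as small
    as possible.  In terms of disagreement probabilities, extend the
    coordinates antiperiodically, y_{j+n} = 1 - y_j and Y_{j+n} = not Y_j:
    then all n edges of the cycle, the positive one included, ask for
    P(Y_j <> Y_{j+1}) to be as small as possible, namely
    d_j = |y_j - y_{j+1}|.  Going once around the cycle turns Y_0 into its
    negation, so some edge disagrees and the n disagreement probabilities add
    up to at least 1.  If D, the sum of the d_j, is at least 1 then all lower
    bounds can be met together; otherwise the missing 1 - D can be put on any
    one edge k ([cycle_coupling]).  A computation gives gap = (1 - D) / 2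
    ([cycle_gapE]), and the excess max(0, 1 - D) on edge k costs
    max(0, gap) times |a_k|, or times 1 on the positive edge
    ([convex_le_repair]).  The cheapest edge gives c max(0, gap).

    The antiperiodic form makes the n edges interchangeable, so
    [cycle_coupling] reduces to a path that starts just after edge k.  On the
    path the bits are drawn one at a time with the least disagreement with
    the previous bit, and with the largest disagreement with the first bit
    that this permits ([coupled_bit], [path_coupling]). *)

(** * Finite probability spaces *)

Definition prob_weights (R : realFieldType) (T : finType) (w : T -> R) :=
  (forall s, 0 <= w s) /\ \sum_s w s = 1.

Definition mean (R : realFieldType) (T : finType) (w F : T -> R) : R :=
  \sum_s w s * F s.

(** The probability that the bit [b] differs from a random bit that is true
    with probability [r]. *)
Definition flip (R : realFieldType) (b : bool) (r : R) : R :=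
  if b then 1 - r else r.

Lemma eq_mean (R : realFieldType) (T : finType) (w F G : T -> R) :
  F =1 G -> mean w F = mean w G.
Proof. by move=> FG; apply: eq_bigr => s _; rewrite FG. Qed.

Lemma mean_cst (R : realFieldType) (T : finType) (w : T -> R) c :
  prob_weights w -> mean w (fun=> c) = c.
Proof. by case=> _ w1; rewrite /mean -mulr_suml w1 mul1r. Qed.

Lemma meanD (R : realFieldType) (T : finType) (w F G : T -> R) :
  mean w (fun s => F s + G s) = mean w F + mean w G.
Proof. by rewrite /mean -big_split; apply: eq_bigr => s _; rewrite mulrDr. Qed.

Lemma meanZ (R : realFieldType) (T : finType) (w F : T -> R) c :
  mean w (fun s => c * F s) = c * mean w F.
Proof. by rewrite /mean mulr_sumr; apply: eq_bigr => s _; rewrite mulrCA. Qed.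

Lemma mean_sum (R : realFieldType) (T I : finType) (w : T -> R)
    (F : I -> T -> R) (c : I -> R) :
  mean w (fun s => \sum_i c i * F i s) = \sum_i c i * mean w (F i).
Proof.
rewrite /mean; under eq_bigr => s _ do rewrite mulr_sumr.
rewrite exchange_big; apply: eq_bigr => i _; rewrite mulr_sumr.
by apply: eq_bigr => s _; rewrite mulrCA.
Qed.

Lemma mean_ge0 (R : realFieldType) (T : finType) (w F : T -> R) :
  prob_weights w -> (forall s, 0 <= F s) -> 0 <= mean w F.
Proof. by case=> w0 _ F0; apply: sumr_ge0 => s _; rewrite mulr_ge0. Qed.

Lemma mean_compl (R : realFieldType) (T : finType) (w F : T -> R) :
  prob_weights w -> mean w (fun s => 1 - F s) = 1 - mean w F.
Proof.
move=> dw; rewrite -[in RHS](mean_cst 1 dw) -mulN1r -meanZ -meanD.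
by apply: eq_mean => s; rewrite mulN1r.
Qed.

Lemma mean_neg (R : realFieldType) (T : finType) (w : T -> R) (U : pred T) :
  prob_weights w ->
  mean w (fun s => (~~ U s)%:R) = 1 - mean w (fun s => (U s)%:R).
Proof.
move=> dw; rewrite -mean_compl//; apply: eq_mean => s.
by case: (U s); rewrite /= ?subrr ?subr0.
Qed.

(** * Drawing a bit that depends on two others *)

(** A conditional probability e / p that makes sense for p = 0 as well. *)
Lemma fraction_of (R : realFieldType) (p e : R) :
  0 <= e <= p -> exists2 c, 0 <= c <= 1 & c * p = e.
Proof.
move=> /andP[e0 ep]; have p0 := le_trans e0 ep.
have [p00|pn0] := eqVneq p 0.
  by exists 0; rewrite ?lexx ?ler01// mul0r; apply/eqP; lra.
have p_gt0 : 0 < p by rewrite lt_def pn0.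
by exists (e / p); rewrite ?divfK// divr_ge0//= ler_pdivrMr ?mul1r.
Qed.

(** Two bits have a joint law with three degrees of freedom, so the mean of
    any function of them is an affine combination of the same three means.
    This turns the probability computations below into linear arithmetic. *)
Lemma mean_two_bits (R : realFieldType) (T : finType) (w : T -> R)
    (U V : pred T) (a b c d : R) (F : T -> R) :
  prob_weights w ->
  (forall s, F s = a + b * (U s)%:R + c * (V s)%:R + d * (U s && V s)%:R) ->
  mean w F = a + b * mean w (fun s => (U s)%:R)
    + c * mean w (fun s => (V s)%:R) + d * mean w (fun s => (U s && V s)%:R).
Proof.
move=> dw FE; rewrite -!meanZ -[in RHS](mean_cst a dw) -!meanD.
exact: eq_mean.
Qed.

(** The new bit [k] (given by its conditional probability of being true) has
    to be at least [V], and then disagrees with [V] with probability v - EV,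
    the least possible.  The only freedom is where the mass v - EV of newly
    true outcomes goes: those with U = V = 0 create a disagreement with [U],
    those with U = 1 and V = 0 destroy one.  Filling the former first gives
    the largest disagreement with [U]: either all the mass fits there, or the
    event U = k = 0 becomes empty. *)
Lemma coupled_bit_up (R : realFieldType) (T : finType) (w : T -> R)
    (U V : pred T) (v : R) :
  prob_weights w -> mean w (fun s => (V s)%:R) <= v <= 1 ->
  exists k : T -> R, [/\ forall s, 0 <= k s <= 1,
    mean w k = v,
    mean w (fun s => flip (V s) (k s)) = v - mean w (fun s => (V s)%:R)
  & mean w (fun s => flip (U s) (k s)) =
      Num.min (1 - `|1 - mean w (fun s => (U s)%:R) - v|)
        (mean w (fun s => (U s (+) V s)%:R)
         + (v - mean w (fun s => (V s)%:R)))].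
Proof.
move=> dw.
have EUxV : mean w (fun s => (U s (+) V s)%:R) =
    0 + 1 * mean w (fun s => (U s)%:R) + 1 * mean w (fun s => (V s)%:R)
    + (- 2) * mean w (fun s => (U s && V s)%:R).
  by apply: mean_two_bits => // s; case: (U s); case: (V s) => /=; ring.
have p11 : 0 <= mean w (fun s => (U s && V s)%:R) by apply: mean_ge0.
have p10 : 0 <= mean w (fun s => (U s && ~~ V s)%:R) by apply: mean_ge0.
have p01 : 0 <= mean w (fun s => (~~ U s && V s)%:R) by apply: mean_ge0.
have p00 : 0 <= mean w (fun s => (~~ U s && ~~ V s)%:R) by apply: mean_ge0.
have E10 : mean w (fun s => (U s && ~~ V s)%:R) =
    0 + 1 * mean w (fun s => (U s)%:R) + 0 * mean w (fun s => (V s)%:R)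
    + (- 1) * mean w (fun s => (U s && V s)%:R).
  by apply: mean_two_bits => // s; case: (U s); case: (V s) => /=; ring.
have E01 : mean w (fun s => (~~ U s && V s)%:R) =
    0 + 0 * mean w (fun s => (U s)%:R) + 1 * mean w (fun s => (V s)%:R)
    + (- 1) * mean w (fun s => (U s && V s)%:R).
  by apply: mean_two_bits => // s; case: (U s); case: (V s) => /=; ring.
have E00 : mean w (fun s => (~~ U s && ~~ V s)%:R) =
    1 + (- 1) * mean w (fun s => (U s)%:R) + (- 1) * mean w (fun s => (V s)%:R)
    + 1 * mean w (fun s => (U s && V s)%:R).
  by apply: mean_two_bits => // s; case: (U s); case: (V s) => /=; ring.
rewrite {}E10 {}E01 {}E00 in p10 p01 p00.
have twoE := @mean_two_bits R T w U V _ _ _ _ _ dw.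
rewrite {}EUxV; move: p11 p10 p01 p00 twoE.
set x := mean w (fun s => (U s)%:R); set y := mean w (fun s => (V s)%:R).
set z := mean w (fun s => (U s && V s)%:R).
move=> p11 p10 p01 p00 twoE /andP[yv v1].
(* [e] is the part of the mass v - y put on the event U = V = 0, whose
   probability is 1 - x - y + z. *)
pose e := Num.min (v - y) (1 - x - y + z).
have eE : e = v - y \/ e = 1 - x - y + z.
  by rewrite /e; case: leP => _; [left|right].
have e0 : 0 <= e by rewrite le_min; apply/andP; split; lra.
have [e1 e2] : e <= v - y /\ e <= 1 - x - y + z.
  by rewrite !ge_min !lexx orbT.
have [|al al01 alE] := @fraction_of R (1 - x - y + z) e; first by rewrite e0 e2.
have [|be be01 beE] := @fraction_of R (x - z) (v - y - e).
  by apply/andP; split; first lra; case: eE => ->; lra.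
exists (fun s => if V s then 1 else if U s then be else al); split.
- by move=> s; case: (V s); case: (U s); rewrite ?ler01 ?lexx.
- rewrite (twoE al (be - al) (1 - al) (al - be)); first lra.
  by move=> s; rewrite /flip; case: (U s); case: (V s) => /=; ring.
- rewrite (twoE al (be - al) (- al) (al - be)); first lra.
  by move=> s; rewrite /flip; case: (U s); case: (V s) => /=; ring.
- rewrite (twoE al (1 - be - al) (1 - al) (be + al - 2)); last first.
    by move=> s; rewrite /flip; case: (U s); case: (V s) => /=; ring.
  transitivity (x + y - 2 * z + 2 * e - (v - y)); first lra.
  rewrite /e; case: leP => h; [rewrite min_r|rewrite min_l]; try lra.
  + by case: (ger0P (1 - x - v)); lra.
  + by rewrite ler0_norm; lra.
  + by case: (ger0P (1 - x - v)); lra.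
Qed.

(** Decreasing the mean amounts to increasing it for the negated bits. *)
Lemma coupled_bit (R : realFieldType) (T : finType) (w : T -> R)
    (U V : pred T) (v : R) :
  prob_weights w -> 0 <= v <= 1 ->
  exists k : T -> R, [/\ forall s, 0 <= k s <= 1,
    mean w k = v,
    mean w (fun s => flip (V s) (k s)) = `|mean w (fun s => (V s)%:R) - v|
  & mean w (fun s => flip (U s) (k s)) =
      Num.min (1 - `|1 - mean w (fun s => (U s)%:R) - v|)
        (mean w (fun s => (U s (+) V s)%:R)
         + `|mean w (fun s => (V s)%:R) - v|)].
Proof.
move=> dw /andP[v0 v1].
have [Vv|vV] := lerP (mean w (fun s => (V s)%:R)) v.
  have [|k [k01 kv Vk Uk]] := @coupled_bit_up R T w U V v dw.
    by rewrite Vv.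
  by exists k; split=> //; rewrite ?Vk ?Uk ?opprB.
have [|k [k01 kv Vk Uk]] :=
  @coupled_bit_up R T w (fun s => ~~ U s) (fun s => ~~ V s) (1 - v) dw.
  by rewrite mean_neg//; lra.
exists (fun s => 1 - k s); split.
- by move=> s; have := k01 s; lra.
- by rewrite mean_compl// kv; lra.
- transitivity (mean w (fun s => flip (~~ V s) (k s))).
    by apply: eq_mean => s; rewrite /flip; case: (V s) => //=; ring.
  by rewrite Vk mean_neg//; lra.
- transitivity (mean w (fun s => flip (~~ U s) (k s))).
    by apply: eq_mean => s; rewrite /flip; case: (U s) => //=; ring.
  rewrite Uk !mean_neg//; congr Num.min.
    by rewrite -normrN; congr (1 - `|_|); ring.
  congr (_ + _); last lra.
  by apply: eq_mean => s; case: (U s); case: (V s).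
Qed.

(** The space enlarged by one bit, whose conditional law is [k]. *)
Definition draw_bit (R : realFieldType) (T : finType) (w k : T -> R)
    (p : T * bool) : R :=
  w p.1 * (if p.2 then k p.1 else 1 - k p.1).

Lemma mean_draw_bit (R : realFieldType) (T : finType) (w k : T -> R)
    (F : T -> bool -> R) :
  mean (draw_bit w k) (fun p => F p.1 p.2) =
  mean w (fun s => k s * F s true + (1 - k s) * F s false).
Proof.
rewrite /mean /draw_bit -(pair_bigA _ (fun s b =>
  w s * (if b then k s else 1 - k s) * F s b)) /=.
by apply: eq_bigr => s _; rewrite big_bool /=; ring.
Qed.

Lemma draw_bit_weights (R : realFieldType) (T : finType) (w k : T -> R) :
  prob_weights w -> (forall s, 0 <= k s <= 1) -> prob_weights (draw_bit w k).
Proof.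
move=> dw k01; split=> [[s b]|].
  apply: mulr_ge0; first by case: dw.
  by have /andP[] := k01 s; case: b => //=; lra.
transitivity (mean (draw_bit w k) (fun=> 1)).
  by apply: eq_bigr => p _; rewrite mulr1.
rewrite (mean_draw_bit w k (fun _ _ => 1)) -[RHS](mean_cst 1 dw).
by apply: eq_mean => s; ring.
Qed.

(** * Couplings along a path and around a cycle *)

(** Each new bit is chosen by [coupled_bit] relative to the first and the last
    of the previous ones.  The recursion that this gives for the disagreement
    of the two ends is solved by the minimum of the two obvious upper bounds:
    the one forced by the marginals of the ends, and the union bound. *)
Lemma path_coupling (R : realFieldType) (y : nat -> R) (m : nat) :
  (forall j, 0 <= y j <= 1) ->
  exists (T : finType) (w : T -> R) (Y : nat -> pred T),
  [/\ prob_weights w,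
      forall j, (j <= m)%N -> mean w (fun s => (Y j s)%:R) = y j,
      forall j, (j < m)%N ->
        mean w (fun s => (Y j s (+) Y j.+1 s)%:R) = `|y j - y j.+1|
    & mean w (fun s => (Y 0%N s (+) Y m s)%:R) =
        Num.min (1 - `|1 - y 0%N - y m|) (\sum_(j < m) `|y j - y j.+1|)].
Proof.
move=> y01; elim: m => [|m [T [w [Y [dw Yy Yd Ye]]]]].
  have du : prob_weights (fun _ : unit => 1 : R).
    by split=> //; rewrite sumr_const card_unit.
  exists (unit * bool)%type, (draw_bit (fun=> 1) (fun=> y 0%N)), (fun _ => snd).
  split=> //; first exact: draw_bit_weights.
    move=> j; rewrite leqn0 => /eqP ->.
    rewrite (mean_draw_bit _ _ (fun _ b => b%:R)) -[RHS](mean_cst _ du).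
    by apply: eq_mean => s /=; ring.
  rewrite big_ord0 min_r; last first.
    by case: (ger0P (1 - y 0%N - y 0%N)) => _; have := y01 0%N; lra.
  transitivity (mean (draw_bit (fun _ : unit => 1) (fun=> y 0%N)) (fun=> 0)).
    by apply: eq_mean => -[s b] /=; rewrite addbb.
  by rewrite mean_cst//; exact: draw_bit_weights.
have [k [k01 ky Yk Y0k]] := coupled_bit (Y 0%N) (Y m) dw (y01 m.+1).
exists (T * bool)%type, (draw_bit w k),
  (fun j p => if (j <= m)%N then Y j p.1 else p.2).
have Kfst F : mean (draw_bit w k) (fun p => F p.1) = mean w F.
  rewrite (mean_draw_bit w k (fun s _ => F s)).
  by apply: eq_mean => s; ring.
have Kxor U : mean (draw_bit w k) (fun p => (U p.1 (+) p.2)%:R) =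
    mean w (fun s => flip (U s) (k s)).
  rewrite (mean_draw_bit w k (fun s b => (U s (+) b)%:R)).
  by apply: eq_mean => s; rewrite /flip; case: (U s) => /=; ring.
split.
- exact: draw_bit_weights.
- move=> j; rewrite [(j <= m.+1)%N]leq_eqVlt => /predU1P[->|]; last first.
    by rewrite ltnS => jm; rewrite jm (Kfst (fun s => (Y j s)%:R)) Yy.
  rewrite ltnn (mean_draw_bit w k (fun _ b => b%:R)) -ky.
  by apply: eq_mean => s /=; ring.
- move=> j; rewrite ltnS => jm.
  have /predU1P[->|jm'] : (j == m) || (j < m)%N by rewrite -leq_eqVlt.
    by rewrite leqnn ltnn (Kxor (Y m)) Yk Yy.
  by rewrite jm jm' (Kfst (fun s => (Y j s (+) Y j.+1 s)%:R)) Yd.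
- rewrite leq0n ltnn (Kxor (Y 0%N)) Y0k !Yy// Ye big_ord_recr /=.
  rewrite addr_minl minA; congr Num.min; rewrite min_l//.
  (* The bound from the marginals of the ends before the step is implied by
     the one after the step, by the triangle inequality. *)
  have := ler_normD (1 - y 0%N - y m.+1) (y m.+1 - y m).
  rewrite -[`|y m.+1 - _|]normrN opprB.
  by rewrite addrA subrK; lra.
Qed.

(** For an involution [c], this is the extension of the first [n] terms of [f]
    with antiperiod [n].  It serves for real numbers with r |-> 1 - r and for
    random bits with negation. *)
Definition antiperiodic_ext (A : Type) (c : A -> A) (n : nat) (f : nat -> A)
    (j : nat) : A :=
  iter (j %/ n) c (f (j %% n)%N).

Lemma antiperiodic_ext_small (A : Type) (c : A -> A) n (f : nat -> A) j :
  (j < n)%N -> antiperiodic_ext c n f j = f j.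
Proof. by move=> jn; rewrite /antiperiodic_ext divn_small// modn_small. Qed.

Lemma antiperiodic_extD (A : Type) (c : A -> A) n (f : nat -> A) j :
  (0 < n)%N -> antiperiodic_ext c n f (j + n) = c (antiperiodic_ext c n f j).
Proof.
by move=> n0; rewrite /antiperiodic_ext divnDr// divnn n0 addn1 modnDr.
Qed.

Lemma period_ind (P : nat -> Prop) (n : nat) : (0 < n)%N ->
  (forall j, (j < n)%N -> P j) -> (forall j, P j -> P (j + n)%N) ->
  forall j, P j.
Proof.
move=> n0 Psmall Pstep j; rewrite (divn_eq j n) addnC.
elim: (j %/ n)%N => [|q IHq].
  by rewrite addn0; apply: Psmall; rewrite ltn_pmod.
by rewrite mulSn [(n + _)%N]addnC addnA; exact: Pstep.
Qed.

Lemma sum_period_shift (R : zmodType) (d : nat -> R) (n k : nat) :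
  (forall j, d (j + n)%N = d j) ->
  \sum_(j < n) d (j + k)%N = \sum_(j < n) d j.
Proof.
case: n => [|m] dn; first by rewrite !big_ord0.
elim: k => [|k <-]; first by apply: eq_bigr => j _; rewrite addn0.
rewrite big_ord_recr [RHS]big_ord_recl /= addrC; congr (_ + _).
  by rewrite addnS -addSn addnC dn.
by apply: eq_bigr => j _; rewrite /= /bump leq0n add1n addSnnS.
Qed.

(** Edge [k] joins positions k and k+1.  Apply [path_coupling] to the positions
    k+1, ..., k+n, where n = m+1, which use every edge but [k]; position k+n
    carries the negation of position k.  Thus edge [k] disagrees exactly when
    the two ends of the path agree, which has probability
    1 - min(1 - d_k, D - d_k) = d_k + max(0, 1 - D). *)
Lemma cycle_coupling (R : realFieldType) (y : nat -> R) (m k : nat) :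
  (forall j, 0 <= y j <= 1) -> (forall j, y (j + m.+1)%N = 1 - y j) ->
  (k <= m)%N ->
  exists (T : finType) (w : T -> R) (Y : nat -> pred T),
  [/\ prob_weights w,
      forall j, mean w (fun s => (Y j s)%:R) = y j,
      forall j s, Y (j + m.+1)%N s = ~~ Y j s
    & forall j, (j <= m)%N ->
        mean w (fun s => (Y j s (+) Y j.+1 s)%:R) = `|y j - y j.+1|
          + (j == k)%:R * Num.max 0 (1 - \sum_(i < m.+1) `|y i - y i.+1|)].
Proof.
move=> y01 yn km; pose d j := `|y j - y j.+1|.
have dn j : d (j + m.+1)%N = d j.
  by rewrite /d -addSn !yn -normrN; congr (`|_|); ring.
rewrite -/(\sum_(i < m.+1) d i) -(sum_period_shift k.+1 dn).
set D := \sum_(i < _) _.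
have [T [w [Y [dw Yy Yd Ye]]]] :=
  @path_coupling R (fun j => y (j + k.+1)%N) m (fun j => y01 _).
(* [Z j] is to be the bit at position j+k+1 of the cycle. *)
pose Z := antiperiodic_ext (fun (U : pred T) s => ~~ U s) m.+1 Y.
have Zn j s : Z (j + m.+1)%N s = ~~ Z j s by rewrite /Z antiperiodic_extD.
have Zsmall j : (j <= m)%N -> Z j = Y j.
  by move=> jm; rewrite /Z antiperiodic_ext_small.
have Zy j : mean w (fun s => (Z j s)%:R) = y (j + k.+1)%N.
  move: j; apply: (@period_ind _ m.+1) => // [j jm|j IHj].
    by rewrite Zsmall// Yy.
  rewrite -addnAC yn -IHj -mean_neg//.
  by apply: eq_mean => s; rewrite Zn.
have Zd j : mean w (fun s => (Z j s (+) Z j.+1 s)%:R) =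
    d (j + k.+1)%N + ((j %% m.+1)%N == m)%:R * Num.max 0 (1 - D).
  move: j; apply: (@period_ind _ m.+1) => // [j|j IHj].
    rewrite ltnS => jm; rewrite modn_small//.
    have /predU1P[->|jm'] : (j == m) || (j < m)%N by rewrite -leq_eqVlt.
      rewrite eqxx mul1r.
      transitivity (1 - mean w (fun s => (Y 0%N s (+) Y m s)%:R)).
        rewrite -mean_neg//; apply: eq_mean => s.
        rewrite -[m.+1]add0n Zn !Zsmall//.
        by case: (Y 0%N s); case: (Y m s).
      have dm : d (m + k.+1)%N = `|1 - y k.+1 - y (m + k.+1)%N|.
        have Em : ((m + k.+1).+1 = k.+1 + m.+1)%N by lia.
        rewrite /d Em yn -normrN; congr (`|_|); ring.
      rewrite Ye /D big_ord_recr /= -/(d _) dm add0n.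
      rewrite -/(\sum_(i < m) d (i + k.+1)%N).
      set S := \sum_(i < m) _; set e := `|_|.
      by case: (leP (1 - e) S) => ?; [rewrite max_l|rewrite max_r]; lra.
    by rewrite !Zsmall// Yd// (ltn_eqF jm') mul0r addr0.
  rewrite modnDr -addnAC dn -IHj.
  by apply: eq_mean => s; rewrite -addSn !Zn; case: (Z j s); case: (Z j.+1 s).
(* Index j + (m - k) of [Z] is position j + n, hence the negation. *)
exists T, w, (fun j s => ~~ Z (j + (m - k))%N s); split=> //.
- move=> j; rewrite mean_neg// Zy.
  have -> : (j + (m - k) + k.+1 = j + m.+1)%N by lia.
  by rewrite yn opprB addrC subrK.
- by move=> j s; rewrite addnAC Zn.
- move=> j jm.
  transitivity (mean w (fun s =>
      (Z (j + (m - k))%N s (+) Z (j + (m - k)).+1 s)%:R)).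
    by apply: eq_mean => s; rewrite addSn; case: (Z _ s); case: (Z _ s).
  rewrite Zd.
  have -> : (j + (m - k) + k.+1 = j + m.+1)%N by lia.
  rewrite dn; congr (_ + (nat_of_bool _)%:R * _).
  have [jk|kj|->] := ltngtP j k.
  - by rewrite modn_small ?ltn_eqF//; lia.
  - have -> : (j + (m - k) = (j - k.+1) + m.+1)%N by lia.
    by rewrite modnDr modn_small ?ltn_eqF//; lia.
  - by rewrite subnKC// modn_small// eqxx.
Qed.

(** * Convex functions *)

Lemma conv_affine (R : realFieldType) (E : lmodType R) (t : {i01 R})
    (x y : convex_lmodType E) :
  conv t x y = t%:num *: (x : E) + (1 - t%:num) *: (y : E) :> E.
Proof. by []. Qed.

Lemma convR_affine (R : realFieldType) (t : {i01 R}) (a b : R) :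
  conv t (a : R^o) (b : R^o) = t%:num * a + (1 - t%:num) * b :> R.
Proof. by []. Qed.

Lemma convex_function_cst (R : realFieldType) (E : lmodType R)
    (D : set (convex_lmodType E)) (c : R) : convex_function D (fun=> c).
Proof. by move=> t x y _ _; rewrite convmm. Qed.

Lemma convex_functionD (R : realFieldType) (E : lmodType R)
    (D : set (convex_lmodType E)) (f g : E -> R) :
  convex_function D f -> convex_function D g ->
  convex_function D (fun x => f x + g x).
Proof.
move=> cf cg t x y xD yD; rewrite convR_affine.
apply: le_trans (lerD (cf t x y xD yD) (cg t x y xD yD)) _.
by rewrite !convR_affine; lra.
Qed.

Lemma convex_function_max (R : realFieldType) (E : lmodType R)
    (D : set (convex_lmodType E)) (f g : E -> R) :
  convex_function D f -> convex_function D g ->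
  convex_function D (fun x => Num.max (f x) (g x)).
Proof.
move=> cf cg t x y xD yD.
have t0 : 0 <= t%:num :> R by [].
have t1 : 0 <= 1 - t%:num :> R by rewrite subr_ge0.
rewrite ge_max; apply/andP; split.
  apply: le_trans (cf t x y xD yD) _; rewrite !convR_affine.
  by apply: lerD; rewrite ler_wpM2l// le_max lexx.
apply: le_trans (cg t x y xD yD) _; rewrite !convR_affine.
by apply: lerD; rewrite ler_wpM2l// le_max lexx orbT.
Qed.

Lemma convex_functionZ (R : realFieldType) (E : lmodType R)
    (D : set (convex_lmodType E)) (c : R) (f : E -> R) :
  0 <= c -> convex_function D f -> convex_function D (fun x => c * f x).
Proof.
move=> c0 cf t x y xD yD; apply: le_trans (ler_wpM2l c0 (cf t x y xD yD)) _.
by rewrite !convR_affine; lra.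
Qed.

Lemma convex_function_sum (R : realFieldType) (E : lmodType R)
    (D : set (convex_lmodType E)) (I : finType) (P : pred I)
    (f : I -> E -> R) :
  (forall i, convex_function D (f i)) ->
  convex_function D (fun x => \sum_(i | P i) f i x).
Proof.
move=> cf t x y xD yD; rewrite convR_affine !mulr_sumr -big_split.
by apply: ler_sum => i _; exact: cf.
Qed.

Lemma convex_function_coord (R : realFieldType) (n : nat)
    (D : set (convex_lmodType 'rV[R]_n)) (c : R) (j : 'I_n) :
  convex_function D (fun x : 'rV[R]_n => c * x 0 j).
Proof.
by move=> t x y _ _; rewrite convR_affine conv_affine !mxE /=; lra.
Qed.

Lemma unit_cube_convex (R : realType) (n : nat) (t : R) (x y : 'rV[R]_n) :
  0 <= t <= 1 -> unit_cube x -> unit_cube y ->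
  unit_cube (t *: x + (1 - t) *: y).
Proof.
move=> /andP[t0 t1] xc yc j; have /andP[x0 x1] := xc j.
have /andP[y0 y1] := yc j.
by rewrite !mxE; apply/andP; split; nra.
Qed.

Lemma convex_functionP (R : realType) (n : nat) (h : 'rV[R]_n -> R) :
  convex_function (@unit_cube R n) h ->
  forall (t : R) (x y : 'rV[R]_n), 0 <= t <= 1 -> unit_cube x -> unit_cube y ->
  h (t *: x + (1 - t) *: y) <= t * h x + (1 - t) * h y.
Proof.
move=> ch t x y /andP[t0 t1] xc yc.
by have := ch (Itv01 t0 t1) x y; rewrite !inE; apply.
Qed.

(** Membership in the cube is carried along because the induction applies
    convexity to the renormalized barycenter of the tail. *)
Lemma jensen_unit_cube (R : realType) (n : nat) (h : 'rV[R]_n -> R)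
    (I : eqType) (r : seq I) (w : I -> R) (v : I -> 'rV[R]_n) :
  convex_function (@unit_cube R n) h ->
  (forall i, 0 <= w i) -> (forall i, unit_cube (v i)) ->
  \sum_(i <- r) w i = 1 ->
  unit_cube (\sum_(i <- r) w i *: v i) /\
  h (\sum_(i <- r) w i *: v i) <= \sum_(i <- r) w i * h (v i).
Proof.
move=> ch w0 vc; elim: r w w0 => [|i r IHr] w w0.
  by rewrite big_nil => /esym/eqP; rewrite oner_eq0.
rewrite !big_cons => w1.
have s0 : 0 <= \sum_(j <- r) w j by apply: sumr_ge0.
have wi := w0 i.
have [wi1|wi1] := eqVneq (w i) 1.
  have sr0 : \sum_(j <- r) w j = 0 by lra.
  have wr0 j : j \in r -> w j = 0.
    move=> jr; move/eqP: sr0; rewrite psumr_eq0; last by move=> l _; apply: w0.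
    by move=> /allP/(_ _ jr)/implyP/(_ isT)/eqP.
  have -> : \sum_(j <- r) w j *: v j = 0.
    by rewrite big_seq big1// => j /wr0 ->; rewrite scale0r.
  have -> : \sum_(j <- r) w j * h (v j) = 0.
    by rewrite big_seq big1// => j /wr0 ->; rewrite mul0r.
  by rewrite wi1 scale1r mul1r !addr0.
have p0 : 0 < 1 - w i by rewrite lt_def subr_eq0 eq_sym wi1; lra.
have [||] := IHr (fun j => (1 - w i)^-1 * w j).
- by move=> j; rewrite mulr_ge0// invr_ge0 ltW.
- have r1 : \sum_(j <- r) w j = 1 - w i by rewrite -w1 addrC addKr.
  by rewrite -mulr_sumr r1 mulVf// gt_eqF.
have -> : \sum_(j <- r) ((1 - w i)^-1 * w j) *: v j =
    (1 - w i)^-1 *: \sum_(j <- r) w j *: v j.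
  by rewrite scaler_sumr; apply: eq_bigr => j _; rewrite scalerA.
have -> : \sum_(j <- r) (1 - w i)^-1 * w j * h (v j) =
    (1 - w i)^-1 * \sum_(j <- r) w j * h (v j).
  by rewrite mulr_sumr; apply: eq_bigr => j _; rewrite mulrA.
set u := \sum_(j <- r) _ => uc hu.
have wi01 : 0 <= w i <= 1 by lra.
have -> : w i *: v i + u = w i *: v i + (1 - w i) *: ((1 - w i)^-1 *: u).
  by rewrite scalerA mulfV ?gt_eqF// scale1r.
split; first exact: unit_cube_convex.
apply: le_trans (convex_functionP ch wi01 (vc i) uc) _.
rewrite lerD2l mulrC -ler_pdivlMr// mulrC.
exact: hu.
Qed.

(** * The path edges and the gap *)

Lemma sum_edge_tail (R : zmodType) (m : nat) (F : 'I_m.+1 -> R) : (0 < m)%N ->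
  \sum_(i < m) F (edge_tail i) = F ord0 + \sum_(j < m.+1 | (0 < j < m)%N) F j.
Proof.
move=> m0; apply: (addIr (F ord_max)).
rewrite -big_ord_recr (bigD1 ord0)//= (bigD1 ord_max)/=; last first.
  by rewrite -val_eqE /= -lt0n.
rewrite -addrA; congr (_ + _); rewrite addrC; congr (_ + _).
apply: eq_bigl => j; rewrite -!val_eqE /= lt0n; congr (_ && _).
by rewrite ltn_neqAle -ltnS ltn_ord andbT.
Qed.

Lemma sum_edge_head (R : zmodType) (m : nat) (F : 'I_m.+1 -> R) : (0 < m)%N ->
  \sum_(i < m) F (edge_head i) =
  \sum_(j < m.+1 | (0 < j < m)%N) F j + F ord_max.
Proof.
move=> m0; apply: (addrI (F ord0)); rewrite addrA -sum_edge_tail//.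
by rewrite -[LHS]big_ord_recl big_ord_recr.
Qed.

Lemma minr_half (R : realFieldType) (u v : R) :
  Num.min u v = (u + v - `|u - v|) / 2.
Proof. by case: (lerP u v) => uv; lra. Qed.

Lemma max0_half (R : realFieldType) (u : R) : Num.max 0 u = (u + `|u|) / 2.
Proof. by case: (ger0P u) => u0; lra. Qed.

(** Half the amount by which the least possible disagreements around the cycle
    fall short of 1, as [cycle_gapE] shows. *)
Definition cycle_gap (R : realFieldType) (m : nat) (x : 'rV[R]_m.+1) : R :=
  \sum_(i < m) Num.min (x 0 (edge_tail i)) (x 0 (edge_head i))
  - Num.max 0 (x 0 ord0 + x 0 ord_max - 1)
  - \sum_(j < m.+1 | (0 < j < m)%N) x 0 j.

Lemma cycle_gapE (R : realFieldType) (m : nat) (x : 'rV[R]_m.+1) : (0 < m)%N ->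
  cycle_gap x = (1 - \sum_(i < m) `|x 0 (edge_tail i) - x 0 (edge_head i)|
                 - `|x 0 ord0 + x 0 ord_max - 1|) / 2.
Proof.
move=> m0; rewrite /cycle_gap max0_half.
have -> : \sum_(i < m) Num.min (x 0 (edge_tail i)) (x 0 (edge_head i)) =
    (\sum_(i < m) x 0 (edge_tail i) + \sum_(i < m) x 0 (edge_head i)
     - \sum_(i < m) `|x 0 (edge_tail i) - x 0 (edge_head i)|) / 2.
  rewrite -big_split -sumrB mulr_suml; apply: eq_bigr => i _.
  exact: minr_half.
by rewrite (sum_edge_tail (x 0))// (sum_edge_head (x 0))//; lra.
Qed.

(** * The candidate is convex and below the function at the vertices *)

Lemma min_coef_ge0 (R : realType) (m : nat) (a : 'I_m -> R) : 0 <= min_coef a.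
Proof.
by rewrite /min_coef; elim/big_ind: _ => // u v u0 v0; rewrite le_min u0.
Qed.

Lemma min_coef_le1 (R : realType) (m : nat) (a : 'I_m -> R) : min_coef a <= 1.
Proof. exact: bigmin_le_id. Qed.

Lemma min_coef_le (R : realType) (m : nat) (a : 'I_m -> R) i :
  min_coef a <= `|a i|.
Proof. exact: bigmin_le. Qed.

Lemma min_coef_attained (R : realType) (m : nat) (a : 'I_m -> R) :
  min_coef a = 1 \/ exists i, min_coef a = `|a i|.
Proof.
rewrite /min_coef; elim/big_ind: _ => [|u v Pu Pv|i _]; first by left.
  by case: leP.
by right; exists i.
Qed.

(** Both arguments of the outer maximum below are nonnegative combinations of
    maxima of affine functions, because [min_coef a] is at most 1 and at most
    each [- a i]. *)
Lemma cycle_env_convex (R : realType) (m : nat) (a : 'I_m -> R)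
    (D : set (convex_lmodType 'rV[R]_m.+1)) :
  (forall i, a i < 0) -> convex_function D (cycle_env a).
Proof.
move=> a0; set c := min_coef a.
pose M (x : 'rV[R]_m.+1) := Num.max 0 (1 * x 0 ord0 + 1 * x 0 ord_max + (-1)).
pose path (b : 'I_m -> R) (x : 'rV[R]_m.+1) :=
  \sum_(i < m) Num.max (b i * x 0 (edge_tail i)) (b i * x 0 (edge_head i)).
have -> : cycle_env a = fun x => Num.max (M x + path a x)
    ((1 - c) * M x + path (fun i => a i + c) x
     + \sum_(j < m.+1 | (0 < j < m)%N) - c * x 0 j).
  apply/funext => x; rewrite /cycle_env.
  have -> : path a x =
      \sum_(i < m) a i * Num.min (x 0 (edge_tail i)) (x 0 (edge_head i)).
    by apply: eq_bigr => i _; rewrite minr_nMr// ltW.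
  have -> : path (fun i => a i + c) x =
      \sum_(i < m) a i * Num.min (x 0 (edge_tail i)) (x 0 (edge_head i))
      + c * \sum_(i < m) Num.min (x 0 (edge_tail i)) (x 0 (edge_head i)).
    rewrite mulr_sumr -big_split; apply: eq_bigr => i _ /=.
    rewrite -mulrDl minr_nMr//.
    by have := min_coef_le a i; rewrite ltr0_norm// -/c; lra.
  rewrite -mulr_sumr /M !mul1r -/c maxr_pMr ?min_coef_ge0//.
  rewrite mulr0 addr_maxr addr0.
  by congr Num.max; ring.
have cM : convex_function D M.
  apply: convex_function_max; first exact: convex_function_cst.
  apply: convex_functionD; last exact: convex_function_cst.
  by apply: convex_functionD; apply: convex_function_coord.
have cpath b : convex_function D (path b).
  apply: convex_function_sum => i.
  by apply: convex_function_max; apply: convex_function_coord.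
apply: convex_function_max; first exact: convex_functionD.
apply: convex_functionD; last first.
  by apply: convex_function_sum => j; apply: convex_function_coord.
apply: convex_functionD => //.
by apply: convex_functionZ => //; rewrite subr_ge0 min_coef_le1.
Qed.

(** Bounding each minimum by its tail, or each by its head, gives a sum at most
    x_1 + T, or x_n + T.  Hence the gap is nonpositive if x_1 or x_n is 0; if
    both are 1, the term M = 1 makes up for the extra endpoint. *)
Lemma cycle_env_le_vertex (R : realType) (m : nat) (a : 'I_m -> R)
    (v : 'rV[R]_m.+1) :
  (0 < m)%N -> cube_vertices v -> cycle_env a v <= cycle_fun a v.
Proof.
move=> m0 vv.
have minM i j : Num.min (v 0 i) (v 0 j) = v 0 i * v 0 j.
  case: leP => h; move: h;
  by case: (vv i) => ->; case: (vv j) => -> h; lra.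
have maxM : Num.max 0 (v 0 ord0 + v 0 ord_max - 1) = v 0 ord0 * v 0 ord_max.
  case: leP => h; move: h;
  by case: (vv ord0) => ->; case: (vv ord_max) => -> h; lra.
rewrite /cycle_env maxM [X in Num.max 0 X](_ : _ = cycle_gap v); last first.
  by rewrite /cycle_gap maxM.
have gap0 : cycle_gap v <= 0.
  have ht : \sum_(i < m) Num.min (v 0 (edge_tail i)) (v 0 (edge_head i)) <=
      \sum_(i < m) v 0 (edge_tail i).
    by apply: ler_sum => i _; rewrite ge_min lexx.
  have hh : \sum_(i < m) Num.min (v 0 (edge_tail i)) (v 0 (edge_head i)) <=
      \sum_(i < m) v 0 (edge_head i).
    by apply: ler_sum => i _; rewrite ge_min lexx orbT.
  rewrite (sum_edge_tail (v 0))// in ht; rewrite (sum_edge_head (v 0))// in hh.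
  rewrite /cycle_gap maxM.
  by case: (vv ord0) hh ht => ->; case: (vv ord_max) => -> hh ht; lra.
rewrite max_l// mulr0 addr0 addrC lerD2r.
by apply: ler_sum => i _; rewrite minM mulrA.
Qed.

(** * Optimal random vertices *)

(** This is [cycle_coupling] in terms of joint success probabilities, with
    position m the edge between the last and the first coordinate.  On a path
    edge P(U = V = 1) = (EU + EV - P(U <> V)) / 2, so that the excess
    disagreement lowers it; on the last edge the disagreement is with the
    negated first bit, so that the excess raises it. *)
Lemma vertex_coupling (R : realType) (m k : nat) (x : 'rV[R]_m.+1) :
  (0 < m)%N -> (k <= m)%N -> unit_cube x ->
  exists (T : finType) (w : T -> R) (Y : 'I_m.+1 -> pred T),
  [/\ prob_weights w,
      forall j, mean w (fun s => (Y j s)%:R) = x 0 j,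
      forall i : 'I_m,
        mean w (fun s => (Y (edge_tail i) s && Y (edge_head i) s)%:R) =
        Num.min (x 0 (edge_tail i)) (x 0 (edge_head i))
        - (i == k :> nat)%:R * Num.max 0 (cycle_gap x)
    & mean w (fun s => (Y ord0 s && Y ord_max s)%:R) =
        Num.max 0 (x 0 ord0 + x 0 ord_max - 1)
        + (m == k)%:R * Num.max 0 (cycle_gap x)].
Proof.
move=> m0 km xc.
pose y := antiperiodic_ext (fun r : R => 1 - r) m.+1 (fun j => x 0 (inord j)).
have yn j : y (j + m.+1)%N = 1 - y j by rewrite /y antiperiodic_extD.
have yS : y m.+1 = 1 - y 0%N by exact: (yn 0%N).
have yx (j : 'I_m.+1) : y j = x 0 j.
  by rewrite /y antiperiodic_ext_small// inord_val.
have y01 j : 0 <= y j <= 1.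
  move: j; apply: (@period_ind _ m.+1) => // [j jm|j]; last by rewrite yn; lra.
  by rewrite /y antiperiodic_ext_small.
have ym : y m = x 0 ord_max := yx ord_max.
have y0 : y 0%N = x 0 ord0 := yx ord0.
have [T [w [Y [dw Yy Yn Yd]]]] := cycle_coupling y01 yn km.
have gapE : Num.max 0 (1 - \sum_(i < m.+1) `|y i - y i.+1|) =
    2 * Num.max 0 (cycle_gap x).
  rewrite cycle_gapE// big_ord_recr /= yS.
  rewrite ym y0 -normrN.
  have -> : - (x 0 ord_max - (1 - x 0 ord0)) = - (x 0 ord0 + x 0 ord_max - 1).
    by ring.
  rewrite normrN.
  have -> : \sum_(i < m) `|y i - y i.+1| =
      \sum_(i < m) `|x 0 (edge_tail i) - x 0 (edge_head i)|.
    by apply: eq_bigr => i _; rewrite -!yx.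
  set u := `|_|; set s := \sum_(i < m) _.
  by rewrite maxr_pMr// mulr0; congr Num.max; lra.
rewrite gapE in Yd.
have andE (U V : pred T) : mean w (fun s => (U s && V s)%:R) =
    (mean w (fun s => (U s)%:R) + mean w (fun s => (V s)%:R)
     - mean w (fun s => (U s (+) V s)%:R)) / 2.
  have -> := @mean_two_bits R T w U V 0 1 1 (-2)
    (fun s => (U s (+) V s)%:R) dw.
    by lra.
  by move=> s; case: (U s); case: (V s) => /=; ring.
exists T, w, (fun j => Y j); split=> //.
- by move=> j; rewrite Yy yx.
- move=> i; rewrite andE !Yy !yx (Yd i (ltnW (ltn_ord i))) minr_half -!yx; lra.
- have := Yd m (leqnn m); rewrite yS ym y0.
  have -> : mean w (fun s => (Y m s (+) Y m.+1 s)%:R) =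
      1 - mean w (fun s => (Y 0%N s (+) Y m s)%:R).
    rewrite -mean_neg//; apply: eq_mean => s.
    have -> : Y m.+1 s = ~~ Y 0%N s by exact: (Yn 0%N s).
    by case: (Y 0%N s); case: (Y m s).
  rewrite andE !Yy !yx (max0_half (x 0 ord0 + _ - 1)) -normrN.
  have -> : - (x 0 ord_max - (1 - x 0 ord0)) = - (x 0 ord0 + x 0 ord_max - 1).
    by ring.
  by rewrite normrN /=; lra.
Qed.

Lemma convex_le_mean (R : realType) (n : nat) (f h : 'rV[R]_n -> R)
    (T : finType) (w : T -> R) (Y : 'I_n -> pred T) (x : 'rV[R]_n) :
  convex_function (@unit_cube R n) h ->
  (forall v, cube_vertices v -> h v <= f v) ->
  prob_weights w -> (forall j, mean w (fun s => (Y j s)%:R) = x 0 j) ->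
  h x <= mean w (fun s => f (\row_j (Y j s)%:R)).
Proof.
move=> ch hf [w0 w1] Yx; pose v s : 'rV[R]_n := \row_j (Y j s)%:R.
have vc s : unit_cube (v s).
  by move=> j; rewrite mxE; case: (Y j s); rewrite ?lexx ?ler01.
have [_] := jensen_unit_cube ch w0 vc w1.
have -> : \sum_s w s *: v s = x.
  apply/rowP => j; rewrite summxE -Yx; apply: eq_bigr => s _.
  by rewrite !mxE.
move=> hx; apply: le_trans hx _; apply: ler_sum => s _.
apply: ler_wpM2l => //; apply: hf => j; rewrite mxE.
by case: (Y j s); [right|left].
Qed.

(** The cost of putting the excess on edge [k]: the factor of the gap is
    [- a k] if [k] is a path edge, and 1 if k = m. *)
Lemma convex_le_repair (R : realType) (m k : nat) (a : 'I_m -> R)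
    (h : 'rV[R]_m.+1 -> R) (x : 'rV[R]_m.+1) :
  (0 < m)%N -> (k <= m)%N ->
  convex_function (@unit_cube R m.+1) h ->
  (forall v, cube_vertices v -> h v <= cycle_fun a v) -> unit_cube x ->
  h x <= Num.max 0 (x 0 ord0 + x 0 ord_max - 1)
    + \sum_(i < m) a i * Num.min (x 0 (edge_tail i)) (x 0 (edge_head i))
    + ((m == k)%:R - \sum_(i < m | i == k :> nat) a i)
      * Num.max 0 (cycle_gap x).
Proof.
move=> m0 km ch hf xc.
have [T [w [Y [dw Yx Ye Y0m]]]] := vertex_coupling m0 km xc.
apply: le_trans (convex_le_mean ch hf dw Yx) _.
rewrite (_ : mean _ _ = \sum_(i < m) a i *
      mean w (fun s => (Y (edge_tail i) s && Y (edge_head i) s)%:R)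
    + mean w (fun s => (Y ord0 s && Y ord_max s)%:R)); last first.
  rewrite -mean_sum -meanD; apply: eq_mean => s.
  rewrite /cycle_fun !mxE -natrM mulnb; congr (_ + _).
  by apply: eq_bigr => i _; rewrite !mxE -mulrA -natrM mulnb.
rewrite Y0m (eq_bigr _ (fun i _ => congr1 (fun r => a i * r) (Ye i))).
set M := Num.max 0 (_ + _ - 1); set g := Num.max 0 _.
have -> : \sum_(i < m) a i * (Num.min (x 0 (edge_tail i)) (x 0 (edge_head i))
      - (i == k :> nat)%:R * g) =
    \sum_(i < m) a i * Num.min (x 0 (edge_tail i)) (x 0 (edge_head i))
    - (\sum_(i < m | i == k :> nat) a i) * g.
  rewrite [\sum_(i < m | i == k :> nat) a i]big_mkcond mulr_suml -sumrB.
  by apply: eq_bigr => i _; case: (i == k :> nat) => /=; ring.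
by lra.
Qed.

Theorem theorem6 (R : realType) (m : nat) (hn : (3 <= m.+1)%N)
    (a : 'I_m -> R) (ha : forall i : 'I_m, a i < 0) :
  is_convex_envelope (cycle_fun a) (cycle_env a).
Proof.
have m0 : (0 < m)%N by case: (m) hn.
split=> [|v vv|h ch hf x xc]; first exact: cycle_env_convex.
  exact: cycle_env_le_vertex.
rewrite /cycle_env -/(cycle_gap x).
case: (min_coef_attained a) => [->|[i ->]].
  have := convex_le_repair m0 (leqnn m) ch hf xc.
  have -> : \sum_(i < m | i == m :> nat) a i = 0.
    by apply: big_pred0 => i; rewrite ltn_eqF.
  by rewrite eqxx subr0.
have := convex_le_repair m0 (ltnW (ltn_ord i)) ch hf xc.
have -> : \sum_(j < m | j == i :> nat) a j = a i by exact: big_pred1.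
by rewrite gtn_eqF// sub0r ltr0_norm.
Qed.
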